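(* Let $\mathcal{H}=(V,E)$ be a loopless hypergraph such that $$\Delta(\mathcal{H})\le\sqrt{\Delta([\mathcal{H}]_2)+1}+1.$$ Then $\mathrm{q}(\mathcal{H})\le\Delta([\mathcal{H}]_2)+1$.
   Context: A hypergraph $\mathcal{H}=(V,E)$ consists of a finite nonempty set $V$ of vertices and a nonempty set $E$ of nonempty subsets of $V$, called hyperedges. It is not assumed to be linear, i.e. two distinct hyperedges may share more than one vertex. A loop is a hyperedge $e$ with $|e|=1$; $\mathcal{H}$ is loopless if it has no loop. The degree of a vertex $x\in V$ is $\deg_{\mathcal{H}}(x)=|\{a\in E: x\in a\}|$, and the maximum degree of $\mathcal{H}$ is $\Delta(\mathcal{H})=\max_{x\in V}\deg_{\mathcal{H}}(x)$. The 2-section of $\mathcal{H}$ is the loopless multigraph $[\mathcal{H}]_2$ with vertex set $V$ in which two distinct vertices $x,y$ are joined by exactly $m$ parallel edges, where $m$ is the number of hyperedges of $\mathcal{H}$ containing both $x$ and $y$. $\Delta([\mathcal{H}]_2)$ denotes the maximum degree of this multigraph, with edges counted with multiplicity; thus the degree of $x$ in $[\mathcal{H}]_2$ is $\sum_{e\in E,\ x\in e}(|e|-1)$. The chromatic index $\mathrm{q}(\mathcal{H})$ is the least integer $q$ such that there exists a map $c:E\to\{1,2,\dots,q\}$ satisfying: for all $e,e'\in E$, $c(e)=c(e')$ implies $e\cap e'=\varnothing$ or $e=e'$. *)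

(* Defs.v *)
From mathcomp Require Import all_boot all_order all_algebra.

Set Implicit Arguments.
Unset Strict Implicit.
Unset Printing Implicit Defensive.

Record hypergraph (V : finType) := Hypergraph {
  hedges :> {set {set V}};
  vertices_nonempty : 0 < #|V|;
  hedges_nonempty : hedges != set0;
  hedge_nonempty : set0 \notin hedges
}.

Definition is_loop (V : finType) (e : {set V}) : bool := #|e| == 1.

Definition loopless (V : finType) (H : hypergraph V) : bool :=
  [forall e in hedges H, ~~ is_loop e].

Definition hdeg (V : finType) (H : hypergraph V) (x : V) : nat :=
  #|[set a in hedges H | x \in a]|.

Definition hmaxdeg (V : finType) (H : hypergraph V) : nat :=
  \max_(x : V) hdeg H x.

(* A loopless multigraph is encoded by its edge multiplicities: [mult x y] is
   the number of parallel edges joining x and y. *)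
Record multigraph (V : finType) := Multigraph {
  mult : V -> V -> nat;
  mult_sym : forall x y, mult x y = mult y x;
  mult_loopless : forall x, mult x x = 0
}.

Definition mdeg (V : finType) (G : multigraph V) (x : V) : nat :=
  \sum_(y : V) mult G x y.

Definition mmaxdeg (V : finType) (G : multigraph V) : nat :=
  \max_(x : V) mdeg G x.

Section TwoSection.
Variables (V : finType) (H : hypergraph V).

Definition two_section_mult (x y : V) : nat :=
  if x == y then 0 else #|[set e in hedges H | (x \in e) && (y \in e)]|.

Lemma two_section_mult_sym x y : two_section_mult x y = two_section_mult y x.
Proof.
rewrite /two_section_mult eq_sym; case: eqP => // _.
by congr #|pred_of_set _|; apply/setP => e; rewrite !inE [(x \in e) && _]andbC.
Qed.

Lemma two_section_mult_loopless x : two_section_mult x x = 0.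
Proof. by rewrite /two_section_mult eqxx. Qed.

Definition two_section : multigraph V :=
  Multigraph two_section_mult_sym two_section_mult_loopless.

Lemma mdeg_two_section x :
  mdeg two_section x = \sum_(e in hedges H | x \in e) (#|e| - 1).
Proof.
rewrite /mdeg /= (bigD1 x) //= two_section_mult_loopless add0n.
under eq_bigr => y yx.
  rewrite /two_section_mult eq_sym (negPf yx) -sum1dep_card.
  under eq_bigl => e do rewrite andbA.
  rewrite big_mkcondr /=.
  over.
rewrite exchange_big /=; apply: eq_bigr => e /andP[_ xe].
rewrite -big_mkcondr /= sum1_card [in RHS](cardD1 x) xe add1n subn1 /=.
exact: eq_card.
Qed.

End TwoSection.

Section ChromaticIndex.
Variables (V : finType) (H : hypergraph V).

Definition hedge : finType := {e : {set V} | e \in hedges H}.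

(* The color set {1, ..., q} is represented by 'I_q = {0, ..., q - 1}. *)
Definition proper_coloring (q : nat) (c : {ffun hedge -> 'I_q}) : bool :=
  [forall e, forall e', (c e == c e') ==>
     ((val e :&: val e' == set0) || (e == e'))].

Definition edge_colorable (q : nat) : bool :=
  [exists c : {ffun hedge -> 'I_q}, proper_coloring c].

Lemma edge_colorable_ex : exists q, edge_colorable q.
Proof.
exists #|hedge|; apply/existsP; exists [ffun e => enum_rank e].
apply/forallP => e; apply/forallP => e'; apply/implyP.
by rewrite !ffunE => /eqP/enum_rank_inj ->; rewrite eqxx orbT.
Qed.

Definition chromatic_index : nat := ex_minn edge_colorable_ex.

End ChromaticIndex.

(* Main.v *)
(** Put [M] for the maximum degree of the 2-section and [s] for the maximum
    degree of the hypergraph minus one, so that [s ^ 2 <= M + 1].  In a set [S]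
    of hyperedges, an edge [e] of smallest size [k] meets at most
    [\sum_(x in e) (d x - 1)] others, where [d x <= s + 1] and
    [(k - 1) * d x <= M]; this is at most [M], which leaves a colour for [e],
    unless [k = s], [s ^ 2 = M + 1], and every vertex of [e] lies on exactly
    [s + 1] edges of [S], all of size [s].  If no edge of [S] can be removed,
    the edges of size [s] are therefore not met by the others, they meet at most
    [M + 1] edges each, where [M + 1 >= 4], and they contain no clique of size
    [M + 2]; Brooks' theorem colours them with [M + 1] colours.  Brooks' theorem
    follows Zajac's argument: a maximal path closes up into a cycle around which
    a partial colouring extends. *)

Require Import Defs.
From mathcomp Require Import all_boot all_order all_algebra.
From mathcomp Require Import zify.

Set Implicit Arguments.
Unset Strict Implicit.
Unset Printing Implicit Defensive.

(** * Brooks' theorem for vertex subsets of a finite graph *)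

Section Brooks.
Variables (T C : finType) (adj : rel T).
Hypotheses (adjC : symmetric adj) (adjxx : irreflexive adj).
Implicit Types (W D : {set T}) (c : T -> C) (p q : seq T).

Definition nbr W x : {set T} := [set y in W | adj x y].

(** Colourings are total functions whose values off [W] are irrelevant, so a partial colouring is
    extended by enlarging the set. *)
Definition proper_on W c : Prop :=
  forall x y, x \in W -> y \in W -> adj x y -> c x != c y.

Lemma nbrS W D x : D \subset W -> nbr D x \subset nbr W x.
Proof.
move=> sDW; apply/subsetP => y; rewrite !inE => /andP[yD ->].
by rewrite (subsetP sDW).
Qed.

Lemma proper_recolor D c x a :
  proper_on D c -> a \notin [set c y | y in nbr D x] ->
  proper_on (x |: D) (fun y => if y == x then a else c y).
Proof.
move=> pc aN y z; rewrite !inE.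
have aD t : t \in D -> adj x t -> c t != a.
  by move=> tD xt; apply: contraNneq aN => <-; apply: imset_f; rewrite inE tD.
case: (eqVneq y x) => [->|_] /=; case: (eqVneq z x) => [->|_] //=.
- by rewrite adjxx.
- by move=> _ zD xz; rewrite eq_sym aD.
- by move=> yD _ yx; rewrite aD // adjC.
- exact: pc.
Qed.

(** The bound counts the colours seen, not the neighbours, so that a repeated colour can be
    exploited. *)
Lemma proper_extend D c x :
  x \notin D -> proper_on D c -> #|[set c y | y in nbr D x]| < #|C| ->
  exists2 c', proper_on (x |: D) c' & {in D, c' =1 c}.
Proof.
move=> xD pc; rewrite -cardsT => lt.
have /set0Pn[a] : ~: [set c y | y in nbr D x] != set0.
  by rewrite -card_gt0 cardsCs setCK -cardsT subn_gt0.
rewrite inE => aN; eexists; first exact: proper_recolor pc aN.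
by move=> y yD; case: eqP => // yx; rewrite -yx yD in xD.
Qed.

(* Along a path, each vertex is coloured while its successor is not, so one of
   its at most [#|C|] neighbours does not constrain it. *)
Lemma proper_extend_path W D c p z :
  {in W, forall x, #|nbr W x| <= #|C|} -> D \subset W ->
  {subset rcons p z <= W} -> {in rcons p z, forall x, x \notin D} ->
  sorted adj (rcons p z) -> uniq (rcons p z) -> proper_on D c ->
  exists2 c', proper_on (D :|: [set x in p]) c' & {in D, c' =1 c}.
Proof.
move=> degW; elim: p D c => [|x p IH] D c sDW sW dis.
  move=> _ _ pc; exists c => //.
  by rewrite (_ : [set x in [::]] = set0) ?setU0 //; apply/setP => x; rewrite !inE.
rewrite rcons_cons /= => pth /andP[xp up] pc.
have xW : x \in W by apply: sW; rewrite rcons_cons mem_head.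
have xD : x \notin D by apply: dis; rewrite rcons_cons mem_head.
have [y yp xy] : exists2 y, y \in rcons p z & adj x y.
  case: (p) pth => [|y q] /= /andP[xy _]; first by exists z; rewrite ?mem_head.
  by exists y; rewrite ?mem_head.
have lt : #|[set c y | y in nbr D x]| < #|C|.
  apply: leq_trans (degW x xW); apply: leq_ltn_trans (leq_imset_card _ _) _.
  apply: proper_card; apply/properP; split; first exact: nbrS.
  exists y; first by rewrite inE xy sW // rcons_cons inE yp orbT.
  by rewrite inE negb_and dis // rcons_cons inE yp orbT.
have [c1 pc1 e1] := proper_extend xD pc lt.
have [||||c2 pc2 e2] := IH (x |: D) c1 _ _ _ _ up pc1.
- by rewrite subUset sub1set xW.
- by move=> t tp; apply: sW; rewrite rcons_cons inE tp orbT.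
- move=> t tp; rewrite !inE negb_or dis ?rcons_cons ?inE ?tp ?orbT // andbT.
  by apply: contraNneq xp => <-.
- exact: path_sorted pth.
exists c2.
  suff <- : x |: D :|: [set x in p] = D :|: [set x0 in x :: p] by [].
  by apply/setP => t; rewrite !inE; case: (t == x); rewrite ?orbT.
by move=> t tD; rewrite e2 ?e1 // inE tD orbT.
Qed.

(** The colouring is not injective on the coloured neighbours of [z], so they leave a colour
    free. *)
Lemma proper_extend_repeat W D c z u v :
  #|nbr W z| <= #|C| -> D \subset W -> z \notin D -> proper_on D c ->
  u \in nbr D z -> v \in nbr D z -> u != v -> c u = c v ->
  exists c', proper_on (z |: D) c'.
Proof.
move=> deg sDW zD pc uN vN uv cuv.
suff lt : #|[set c y | y in nbr D z]| < #|C|.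
  by have [c' pc' _] := proper_extend zD pc lt; exists c'.
apply: leq_trans deg; apply: leq_trans (subset_leq_card (nbrS z sDW)).
rewrite ltn_neqAle leq_imset_card andbT.
by apply: contra uv => /imset_injP inj; apply/eqP/inj.
Qed.

(** Appending unvisited neighbours of the last vertex stops since [W] is finite; the prefix [p] lets
    the start of the path be prescribed. *)
Lemma maximal_path W x p :
  path adj x p -> uniq (x :: p) -> {subset x :: p <= W} ->
  exists q, [/\ path adj x (p ++ q), uniq (x :: p ++ q),
    {subset x :: p ++ q <= W} &
    {subset nbr W (last x (p ++ q)) <= x :: p ++ q}].
Proof.
have [n] := ubnP (#|W| - size p); elim: n p => // n IH p ltn pth up sW.
have [/subsetP sub|/subsetPn[y]] :=
  boolP (nbr W (last x p) \subset [set t in x :: p]).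
  exists [::]; rewrite !cats0; split=> // t /sub.
  by rewrite inE.
rewrite !inE => /andP[yW ly] yp.
have le : size (x :: p) <= #|W|.
  by rewrite -(card_uniqP up); apply: subset_leq_card; apply/subsetP.
have [||||q] := IH (rcons p y).
- by rewrite size_rcons; move: le ltn => /=; lia.
- by rewrite rcons_path pth.
- by rewrite -rcons_cons rcons_uniq up inE yp.
- by move=> t; rewrite -rcons_cons mem_rcons inE => /orP[/eqP->|/sW].
by exists (y :: q); rewrite -cat_rcons.
Qed.

Definition colorable_on W : Prop := exists c, proper_on W c.

(* A cycle one of whose vertices has no neighbour outside: start the colouring
   at such a vertex that follows a vertex [z] having an outside neighbour [u],
   giving it the colour of [u]; then [z], coloured last, sees a colour twice. *)
Lemma colorable_cycle W p a b u :
  {in W, forall x, #|nbr W x| <= #|C|} -> {subset p <= W} ->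
  cycle adj p -> uniq p -> colorable_on (W :\: [set x in p]) ->
  a \in p -> {subset nbr W a <= p} ->
  b \in p -> u \in nbr W b -> u \notin p -> colorable_on W.
Proof.
move=> degW sW cyc up [c pc] ap aN bp ub uNp.
pose closed := [pred x | nbr W x \subset [set y in p]].
have ca : closed a by apply/subsetP => y /aN; rewrite inE.
have cb : ~~ closed b.
  by apply/subsetPn; exists u => //; rewrite inE.
(* Rotating to [b], which is not closed, gives the first closed vertex [w] a predecessor [z] that is
   not closed. *)
have [i0 Ei0 b0] := rot_to bp.
set p0 := rot i0 p in b0.
have m0 : p0 =i p by move=> t; rewrite mem_rot.
have hc : has closed p0 by apply/hasP; exists a; rewrite ?m0.
set i := find closed p0.
have ip : i < size p0 by rewrite -has_find.
have i_gt0 : 0 < i by move: cb; rewrite /i b0 /=; case: (_ \subset _).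
pose w := nth a p0 i; pose z := nth a p0 i.-1.
have cw : closed w by apply: nth_find.
have cz : ~~ closed z.
  have /(before_find a) : i.-1 < find closed p0 by rewrite -/i; lia.
  by move=> ->.
pose q := drop i.+1 p0 ++ take i.-1 p0.
have Eq : rot i p0 = w :: rcons q z.
  rewrite /rot (drop_nth a) // -/w /= /q -cats1 -catA cats1 -take_nth; last by lia.
  by rewrite prednK.
have m1 : w :: rcons q z =i p by move=> t; rewrite -Eq mem_rot m0.
have u1 : uniq (w :: rcons q z) by rewrite -Eq rot_uniq /p0 rot_uniq.
have c1 : cycle adj (w :: rcons q z) by rewrite -Eq !rot_cycle.
move: c1; rewrite /= rcons_path last_rcons => /andP[c1 zw].
have wp : w \in p by rewrite -m1 mem_head.
have zp : z \in p by rewrite -m1 inE mem_rcons mem_head orbT.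
have /subsetPn[v] : ~~ (nbr W z \subset [set y in p]) := cz.
rewrite !inE => /andP[vW zv] vp.
(* The closed vertex [w] has no neighbour off the cycle, so the colour of [v] is free for it. *)
have pc1 := @proper_recolor _ _ w (c v) pc.
set D := W :\: _ in pc pc1.
have sDW : w |: D \subset W by rewrite subUset sub1set sW // subsetDl.
have [|||||c2 pc2 e2] :=
  @proper_extend_path W (w |: D) _ q z degW sDW _ _ _ _ (pc1 _).
- by move=> t tq; apply: sW; rewrite -m1 inE tq orbT.
- move=> t tq; rewrite !inE negb_or -m1 inE tq orbT /= andbT.
  by case/andP: u1 => + _; apply: contraNneq => <-.
- exact: path_sorted c1.
- by case/andP: u1.
- apply/imsetP => -[t]; rewrite !inE => /andP[/andP[tp tW] wt] _.
  have /subsetP/(_ t) : nbr W w \subset [set y in p] := cw.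
  by rewrite !inE tW wt (negPf tp) => /(_ isT).
have vD : v \in D by rewrite !inE vp.
have vw : v != w by apply: contraNneq vp => ->.
have [||||||c3 pc3] :=
  @proper_extend_repeat W _ c2 z v w (degW z (sW z zp)) _ _ pc2.
- rewrite subUset sDW; apply/subsetP => t; rewrite inE => tq; apply: sW.
  by rewrite -m1 inE mem_rcons inE tq !orbT.
- have := u1; rewrite /= mem_rcons inE rcons_uniq negb_or.
  move=> /andP[/andP[wz _]] /andP[zq _].
  by rewrite !inE zp negb_or (negPf zq) eq_sym (negPf wz).
- by rewrite /nbr in_set !in_setU vD orbT zv.
- by rewrite !inE eqxx zw.
- exact: vw.
- by rewrite !e2 ?(negPf vw) ?eqxx // in_setU1 ?vD ?eqxx ?orbT.
exists c3; suff <- : z |: (w |: D :|: [set x in q]) = W by [].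
apply/setP => t; rewrite !inE -m1 !inE mem_rcons inE.
have : t \in w :: rcons q z -> t \in W by rewrite m1 => /sW.
rewrite !inE mem_rcons inE.
by case: (t == z); case: (t == w); case: (t \in q); case: (t \in W) => //= /(_ isT).
Qed.

(** The non-adjacent [x] and [z] get one colour. The rest is coloured greedily: from [z] forward
    until just before [t], then from the end of the path back to [t], whose neighbour [y] is still
    uncoloured. Coloured last, [y] sees a colour twice. *)
Lemma colorable_closed_path W x y z p t :
  {in W, forall x, #|nbr W x| <= #|C|} -> {subset [:: x, y, z & p] <= W} ->
  path adj x [:: y, z & p] -> uniq [:: x, y, z & p] -> ~~ adj x z ->
  colorable_on (W :\: [set v in [:: x, y, z & p]]) ->
  {in [:: x, y, z & p], forall v, {subset nbr W v <= [:: x, y, z & p]}} ->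
  t \in p -> adj y t -> colorable_on W.
Proof.
move=> degW sW pth up nxz [c pc] cl tp yt.
pose P := [:: x, y, z & p]; rewrite -/P in sW up pc cl.
have xP : x \in P by rewrite mem_head.
have zP : z \in P by rewrite !inE eqxx !orbT.
set D0 := W :\: _ in pc.
have nbrP v u : v \in P -> u \in D0 -> ~~ adj v u.
  rewrite in_setD in_set => vP /andP[uP uW].
  by apply: contra uP => vu; apply: (cl v) => //; rewrite inE uW.
have D0P v : v \in P -> v \notin D0 by rewrite in_setD in_set => ->.
(* [c y] is just some colour: no vertex of [D0] is adjacent to [x] or [z]. *)
pose c1 u := if u == x then c y else c u.
have pc1 : proper_on (x |: D0) c1.
  apply: (proper_recolor pc); apply/imsetP => -[u].
  by rewrite in_set => /andP[uD xu] _; rewrite (negPf (nbrP x u xP uD)) in xu.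
pose c2 u := if u == z then c y else c1 u.
have {pc1} pc2 : proper_on (z |: (x |: D0)) c2.
  apply: (proper_recolor pc1); apply/imsetP => -[u].
  rewrite in_set in_setU1 => /andP[+ zu] _.
  case/orP=> [/eqP ux|uD]; first by rewrite ux adjC (negPf nxz) in zu.
  by rewrite (negPf (nbrP z u zP uD)) in zu.
have c2xz : c2 x = c2 z by rewrite /c2 /c1 !eqxx if_same.
clearbody c2; clear c1.
case/splitPr: tp => q1 q2 in P pth up sW cl xP zP D0 D0P nbrP pc pc2 *.
set D2 := z |: _ in pc2.
have [xNp yxz zNp] : [/\ x \notin y :: z :: q1 ++ t :: q2,
    y \notin z :: q1 ++ t :: q2 & z \notin q1 ++ t :: q2].
  by case/and4P: up.
have uq : uniq (q1 ++ t :: q2) by case/and4P: up.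
have sub v : v \in q1 ++ t :: q2 -> v \in P by rewrite !inE => ->; rewrite !orbT.
have D2N v : v \in q1 ++ t :: q2 -> v \notin D2.
  move=> vq; rewrite !in_setU1 !negb_or D0P ?sub // andbT.
  apply/andP; split; first by apply: contraNneq zNp => <-.
  by apply: contraNneq xNp => <-; rewrite !inE vq !orbT.
have yP : y \in P by rewrite !inE eqxx orbT.
have yD2 : y \notin D2.
  rewrite !in_setU1 !negb_or D0P // andbT.
  apply/andP; split; first by apply: contraNneq yxz => ->; rewrite mem_head.
  by apply: contraNneq xNp => <-; rewrite mem_head.
have sD2 : D2 \subset W by rewrite !subUset !sub1set !sW //= subsetDl.
have pth3 : sorted adj (q1 ++ t :: q2).
  by case/and3P: pth => _ _ /path_sorted.
have [||||c3 pc3 e3] := proper_extend_path degW sD2 _ _ _ _ pc2 (p := q1) (z := t).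
- by move=> v vq; apply/sW/sub; rewrite -cat_rcons mem_cat vq.
- by move=> v vq; apply: D2N; rewrite -cat_rcons mem_cat vq.
- by move: pth3; rewrite -cat_rcons => /cat_sorted2[].
- by move: uq; rewrite -cat_rcons cat_uniq => /and3P[].
set D3 := D2 :|: _ in pc3.
have q2sub v : v \in rcons (rev (t :: q2)) y -> v = y \/ v \in t :: q2.
  by rewrite mem_rcons inE mem_rev => /orP[/eqP|]; [left|right].
have sD3 : D3 \subset W.
  rewrite subUset sD2; apply/subsetP => v; rewrite inE => vq.
  by apply/sW/sub; rewrite mem_cat vq.
have yq : y \notin q1 ++ t :: q2 by apply: contra yxz => yq; rewrite inE yq orbT.
have [||||c4 pc4 e4] := proper_extend_path degW sD3 _ _ _ _ pc3
  (p := rev (t :: q2)) (z := y).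
- move=> v /q2sub[->|vq]; apply: sW => //; apply: sub.
  by rewrite mem_cat vq orbT.
- move=> v /q2sub[->|vq]; rewrite in_setU in_set negb_or.
    by rewrite yD2 /=; apply: contra yq; rewrite mem_cat => ->.
  rewrite D2N ?mem_cat ?vq ?orbT //=.
  move: uq; rewrite cat_uniq => /and3P[_ /hasPn/(_ v vq)]; exact.
- rewrite -rev_cons rev_sorted /= adjC yt /=.
  rewrite (eq_path (e' := adj)) => [|u v]; last exact: adjC.
  by move: pth3 => /cat_sorted2[].
- rewrite rcons_uniq mem_rev rev_uniq.
  move: uq; rewrite cat_uniq => /and3P[_ _ ->]; rewrite andbT.
  by apply: contra yq; rewrite mem_cat => ->; rewrite orbT.
set D4 := D3 :|: _ in pc4.
have inD2 : (x \in D2) * (z \in D2) by rewrite !in_setU1 !eqxx !orbT.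
have [||||||c5 pc5] :=
  @proper_extend_repeat W D4 c4 y x z (degW y (sW y yP)) _ _ pc4.
- rewrite subUset sD3; apply/subsetP => v; rewrite inE mem_rev => vq.
  by apply/sW/sub; rewrite mem_cat vq orbT.
- by rewrite in_setU in_setU (negPf yD2) !in_set mem_rev /= -mem_cat.
- rewrite in_set in_setU in_setU inD2 /= adjC.
  by case/andP: pth.
- rewrite in_set in_setU in_setU inD2 /=.
  by case/and3P: pth.
- by apply: contraNneq xNp => ->; rewrite !inE eqxx orbT.
- have inD3 v : v \in D2 -> v \in D3 by move=> vD; rewrite in_setU vD.
  by rewrite !e4 ?inD3 ?inD2 // !e3 ?inD2.
exists c5; suff <- : y |: D4 = W by [].
apply/setP => v; rewrite !inE mem_rev.
have := sW v; rewrite !inE !mem_cat !inE.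
case: (v \in W); rewrite ?andbT ?andbF ?orbF.
  by case: (v == x); case: (v == y); case: (v == z); case: (v \in q1);
     case: (v == t); case: (v \in q2).
by case: (v == x); case: (v == y); case: (v == z); case: (v \in q1);
     case: (v == t); case: (v \in q2) => //= /(_ isT).
Qed.

Theorem brooks W :
  3 <= #|C| -> {in W, forall x, #|nbr W x| <= #|C|} ->
  (forall Q : {set T}, Q \subset W ->
     {in Q &, forall x y, x != y -> adj x y} -> #|Q| <= #|C|) ->
  colorable_on W.
Proof.
move=> C3; have [n] := ubnP #|W|; elim: n W => // n IH W ltn degW clq.
have IHW W' : W' \proper W -> colorable_on W'.
  move=> pW; have sW := proper_sub pW; apply: IH.
  - exact: leq_trans (proper_card pW) ltn.
  - move=> x xW; apply: leq_trans (degW x (subsetP sW x xW)).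
    exact: subset_leq_card (nbrS x sW).
  - by move=> Q sQ; apply: clq; apply: subset_trans sQ sW.
have [W0|[x xW]] := set_0Vmem W.
  have /card_gt0P[a _] : 0 < #|C| by lia.
  by exists (fun=> a) => y z; rewrite W0 inE.
have [lt|ge] := ltnP #|nbr W x| #|C|.
  have [c pc] := IHW _ (properD1 xW).
  have [||c' pc' _] := @proper_extend (W :\ x) c x _ pc.
  - by rewrite !inE eqxx.
  - apply: leq_ltn_trans (leq_imset_card _ _) _.
    exact: leq_ltn_trans (subset_leq_card (nbrS x (subsetDl _ _))) lt.
  by exists c'; rewrite setD1K in pc'.
(* Otherwise [x] and its neighbours would form a clique of more than [#|C|] vertices. *)
have [y [z [yN zN yz nyz]]] : exists y z, [/\ y \in nbr W x, z \in nbr W x,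
    y != z & ~~ adj y z].
  have [/existsP[y /existsP[z /and4P[]]]|/existsPn no] := boolP
    [exists y, exists z, [&& y \in nbr W x, z \in nbr W x, y != z & ~~ adj y z]].
    by exists y, z.
  suff : #|x |: nbr W x| <= #|C|.
    by rewrite cardsU1 inE xW adjxx; lia.
  apply: clq.
    by rewrite subUset sub1set xW; apply/subsetP => y; rewrite inE => /andP[].
  move=> y z; rewrite !in_setU1.
  case/predU1P=> [->|yN] /predU1P[->|zN]; rewrite ?eqxx //.
  - by move: zN; rewrite inE => /andP[].
  - by move: yN; rewrite inE adjC => /andP[].
  - move=> yz; apply: contraT => nyz.
    by have /existsPn/(_ z) := no y; rewrite yN zN yz nyz.
move: (yN) (zN); rewrite !inE => /andP[yW xy] /andP[zW xz].
have neq u v : adj u v -> u != v by apply: contraTneq => ->; rewrite adjxx.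
(* Starting with [y], [x], [z] prepares for [colorable_closed_path], with [x] as the vertex coloured
   last. *)
have [|||q [pth up sW sl]] := @maximal_path W y [:: x; z].
- by rewrite /= adjC xy xz.
- by rewrite /= !inE negb_or yz (eq_sym y) !neq.
- by move=> t; rewrite !inE => /or3P[] /eqP->.
set P := [:: y, x, z & q] in up sW sl; rewrite /= in pth.
set l := last z q in sl.
have [w0 w0P lw0] : exists2 t, t \in P & adj l t.
  (* The predecessor of [l] on the path, which is [x] when [q] is empty. *)
  exists (last x (belast z q)).
    have := mem_last x (belast z q); rewrite inE => /predU1P[->|/mem_belast tq].
      by rewrite !inE eqxx orbT.
    by rewrite 2!inE tq !orbT.
  have : path adj x (z :: q) by case/andP: pth.
  by rewrite lastI rcons_path adjC => /andP[].
have hasP0 : has (adj l) P by apply/hasP; exists w0.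
(* The first path vertex [w] adjacent to [l] starts a cycle containing all neighbours of [l]. *)
set i := find (adj l) P.
have EP : P = take i P ++ nth y P i :: drop i.+1 P.
  by rewrite -drop_nth ?cat_take_drop // -has_find.
set r := take i P in EP; set w := nth y P i in EP; set p := drop _ _ in EP.
have lw : adj l w by apply: nth_find.
have sp t : t \in w :: p -> t \in P by rewrite EP mem_cat => ->; rewrite orbT.
have El : last w p = l.
  by have := congr1 (last y) EP; rewrite last_cat.
have lp : {subset nbr W l <= w :: p}.
  move=> t tN; have := sl t tN; rewrite EP mem_cat => /orP[tr|//].
  have := tr; rewrite in_take ?sl // => /(before_find y).
  by rewrite nth_index ?sl //; move: tN; rewrite inE => /andP[_ ->].
have upp : uniq (w :: p) by move: up; rewrite EP cat_uniq => /and3P[].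
have srt : sorted adj P by [].
have cyc : cycle adj (w :: p).
  rewrite /= rcons_path El lw andbT.
  by move: srt; rewrite EP => /cat_sorted2[].
have col : colorable_on (W :\: [set t in w :: p]).
  apply: IHW; apply/properP; split; first exact: subsetDl.
  by exists w; [apply/sW/sp; rewrite mem_head | rewrite !inE eqxx].
have sWp : {subset w :: p <= W} by move=> t /sp/sW.
have lwp : l \in w :: p by rewrite -El mem_last.
have [/existsP[b /existsP[u /and3P[bp bu up']]]|/existsPn no] := boolP
  [exists b, exists u, [&& b \in w :: p, u \in nbr W b & u \notin w :: p]].
  exact: colorable_cycle degW sWp cyc upp col lwp lp bp bu up'.
have cl b u : b \in w :: p -> u \in nbr W b -> u \in w :: p.
  move=> bp bu; apply: contraT => up'.
  by have /existsPn/(_ u) := no b; rewrite bp bu up'.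
(* A path vertex just before [w] would be a neighbour of [w] off the cycle, which [cl] excludes. *)
have {}EP : P = w :: p.
  case/lastP: r EP => [//|r v] EP; move: srt up; rewrite EP cat_rcons.
  move=> /cat_sorted2[_] /= /andP[vw _].
  rewrite cat_uniq /= => /and3P[_ _] /andP[+ _]; rewrite (cl w) ?mem_head //.
  rewrite inE adjC vw andbT; apply: sW.
  by rewrite EP mem_cat mem_rcons mem_head.
(* Since [x] has at least three neighbours, one of them differs from [y] and [z]. *)
have [t] : exists t, t \in nbr W x :\ y :\ z.
  apply/set0Pn; rewrite -card_gt0 -(ltn_add2l 2).
  have := cardsD1 z (nbr W x :\ y); rewrite in_setD1 eq_sym yz zN /=.
  have := cardsD1 y (nbr W x); rewrite yN => Ey Ez; move: (leq_trans C3 ge).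
  by rewrite Ey Ez.
rewrite !in_setD1 => /and3P[tz ty tN]; rewrite -EP in cl col.
have tq : t \in q.
  have xP : x \in P by rewrite !inE eqxx orbT.
  have := cl x t xP tN; rewrite !inE (negPf tz) (negPf ty) /=.
  move: tN; rewrite inE => /andP[_ xt].
  by rewrite eq_sym (negPf (neq _ _ xt)).
apply: (colorable_closed_path degW sW pth up nyz col _ tq).
  by move=> v vP u; apply: cl.
by move: tN; rewrite inE => /andP[].
Qed.

End Brooks.

(** * The line graph of a set of hyperedges *)

Section LineGraph.
Variable V : finType.
Implicit Types (S Q : {set {set V}}) (e f : {set V}) (x : V).

Definition meets e f : bool := (e != f) && (e :&: f != set0).

Lemma meets_sym : symmetric meets.
Proof. by move=> e f; rewrite /meets eq_sym setIC. Qed.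

Lemma meets_irr : irreflexive meets.
Proof. by move=> e; rewrite /meets eqxx. Qed.

Lemma meetsP e f : reflect (e <> f /\ exists2 x, x \in e & x \in f) (meets e f).
Proof.
apply: (iffP andP) => [[/eqP ef /set0Pn[x]]|[/eqP ef [x xe xf]]].
  by rewrite inE => /andP[xe xf]; split=> //; exists x.
by split=> //; apply/set0Pn; exists x; rewrite inE xe.
Qed.

Definition star S x : {set {set V}} := [set f in S | x \in f].

(** The stars at the vertices of [e], with [e] removed, cover its neighbours. *)
Lemma card_nbr_meets S e :
  e \in S -> #|nbr meets S e| <= \sum_(x in e) #|star S x|.-1.
Proof.
move=> eS; have sub : nbr meets S e \subset \bigcup_(x in e) (star S x :\ e).
  apply/subsetP => f; rewrite inE => /andP[fS /meetsP[ef [x xe xf]]].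
  by apply/bigcupP; exists x; rewrite // !inE fS xf /= andbT eq_sym; apply/eqP.
apply: leq_trans (subset_leq_card sub) _.
elim/big_ind2: _ => [|A m B n lA lB|x xe]; first by rewrite cards0.
  exact: leq_trans (leq_card_setU _ _) (leq_add lA lB).
by rewrite (cardsD1 e (star S x)) inE eS xe.
Qed.

(** With [k = #|A|], the bound by [s] gives [M + 1 <= k * s], and summing the bound by [M] gives
    [k ^ 2 <= M + 1]. Together with [s ^ 2 <= M + 1] this forces [k = s] and [s ^ 2 = M + 1], so
    every term is maximal. *)
Lemma sum_degree_bound (I : finType) (A : {set I}) (t : I -> nat) s M :
  1 < #|A| -> s ^ 2 <= M.+1 ->
  {in A, forall i, t i <= s} ->
  {in A, forall i, #|A|.-1 * (t i).+1 <= M} ->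
  M < \sum_(i in A) t i ->
  [/\ #|A| = s, s ^ 2 = M.+1 & {in A, forall i, t i = s}].
Proof.
set k := #|A| => k2 sM ts tM lt.
have le1 : \sum_(i in A) t i <= k * s by rewrite -sum_nat_const leq_sum.
have le2 : k.-1 * \sum_(i in A) t i + k * k.-1 <= k * M.
  have : \sum_(i in A) k.-1 * (t i).+1 <= \sum_(i in A) M by apply: leq_sum.
  rewrite -big_distrr sum_nat_const /=.
  under eq_bigr do rewrite -addn1.
  by rewrite big_split /= sum1_card -/k mulnDr [k.-1 * k]mulnC.
have ks : k = s.
  have [k1 Ek] : exists k1, k = k1.+2 by exists k.-2; lia.
  by rewrite Ek /= in le1 le2 *; nia.
split=> //; first by rewrite ks in le1; nia.
move=> i iA; apply/eqP; rewrite eqn_leq ts //.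
(* The sum is at least [s ^ 2], so [t i] cannot fall below [s]. *)
have : \sum_(j in A) t j <= t i + k.-1 * s.
  rewrite (bigD1 i) //= leq_add2l /k (cardsD1 i A) iA add1n /= -sum_nat_const.
  rewrite [leqRHS](eq_bigl (fun j => (j \in A) && (j != i))).
    by apply: leq_sum => j /andP[/ts].
  by move=> j; rewrite !inE andbC.
rewrite ks in lt le1 *; move: lt; case: (s) sM => [|s1] /=; nia.
Qed.

(** * Colouring hyperedges under the degree bounds *)

Section Bounded.
Variables (E : {set {set V}}) (s M : nat).
Hypotheses (E2 : {in E, forall e, 1 < #|e|}).
Hypotheses (starE : forall x, #|star E x| <= s.+1).
Hypotheses (sumE : forall x, \sum_(f in star E x) #|f|.-1 <= M).
Hypotheses (sM : s ^ 2 <= M.+1).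

Lemma sum_star S x : S \subset E -> \sum_(f in star S x) #|f|.-1 <= M.
Proof.
move=> sSE; apply: leq_trans (sumE x); rewrite [leqRHS](big_setID (star S x)) /=.
suff -> : star E x :&: star S x = star S x by exact: leq_addr.
by apply/setIidPr/subsetP => f; rewrite !inE => /andP[/(subsetP sSE) -> ->].
Qed.

(** By minimality each edge at [x] contributes at least [#|e|.-1] to [sum_star], so
    [sum_degree_bound] applies to the degrees minus one. The last conclusion isolates the smallest
    edges from the others. *)
Lemma smallest_edge_nbr S e :
  S \subset E -> e \in S -> {in S, forall f, #|e| <= #|f|} ->
  M < #|nbr meets S e| ->
  [/\ #|e| = s, s ^ 2 = M.+1, #|nbr meets S e| <= s ^ 2,
     {in e, forall x, #|star S x| = s.+1} &
     {in e, forall x f, f \in S -> x \in f -> #|f| = s}].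
Proof.
move=> sSE eS emin lt; have eE := subsetP sSE e eS.
have star_gt0 x : x \in e -> 0 < #|star S x|.
  by move=> xe; apply/card_gt0P; exists e; rewrite inE eS.
have star_le x : #|star S x| <= s.+1.
  apply: leq_trans (starE x); apply/subset_leq_card/subsetP => f.
  by rewrite !inE => /andP[/(subsetP sSE) -> ->].
have [|||||es sE tE] := @sum_degree_bound _ e (fun x => #|star S x|.-1) s M.
- exact: E2.
- exact: sM.
- by move=> x _; have := star_le x; lia.
- move=> x xe; rewrite prednK ?star_gt0 //; apply: leq_trans (sum_star x sSE).
  rewrite mulnC -sum_nat_const; apply: leq_sum => f; rewrite inE => /andP[fS _].
  by have := emin f fS; lia.
- exact: leq_trans lt (card_nbr_meets eS).
have starS x : x \in e -> #|star S x| = s.+1.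
  by move=> xe; have := tE x xe; have := star_gt0 x xe; lia.
split=> //.
  apply: leq_trans (card_nbr_meets eS) _; rewrite (eq_bigr (fun=> s)) //.
  by rewrite sum_nat_const es.
move=> x xe f fS xf; apply/eqP; rewrite eqn_leq -{2}es emin // andbT.
have fx : f \in star S x by rewrite inE fS.
have cs : #|star S x :\ f| = s.
  by have := cardsD1 f (star S x); rewrite fx starS // add1n => - [].
(* The [s] other edges at [x] have size at least [s]; as [M] is [s ^ 2 - 1], this leaves
   [#|f| <= s]. *)
have le : #|f|.-1 + s * s.-1 <= M.
  apply: leq_trans (sum_star x sSE); rewrite (big_setD1 f fx) /= leq_add2l.
  rewrite -[X in X * _]cs -sum_nat_const; apply: leq_sum => g.
  by rewrite !inE => /and3P[_ /emin + _]; lia.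
by have := E2 eE; rewrite es; case: (s) sE le => [|s1] /=; nia.
Qed.

(* A clique of [s ^ 2 + 1] edges would contain every edge of [S] meeting one of
   its members, hence have [s + 1] edges at each vertex it covers; then [s + 1]
   would divide the number [s * (s ^ 2 + 1)] of incidences, whence [s <= 1]. *)
Lemma clique_bound S Q :
  1 < s -> Q \subset S -> {in Q, forall f, #|f| = s} ->
  {in Q, forall f, #|nbr meets S f| <= s ^ 2} ->
  {in Q, forall f, {in f, forall x, #|star S x| = s.+1}} ->
  {in Q &, forall e f, e != f -> meets e f} -> #|Q| <= s ^ 2.
Proof.
move=> s2 sQS Qs Qn Qst Qcl; rewrite leqNgt; apply/negP => lt.
(* [Q :\ f] consists of at least [s ^ 2] neighbours of [f], and [f] has no more. *)
have nbrQ f : f \in Q -> Q :\ f = nbr meets S f /\ #|Q| = (s ^ 2).+1.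
  move=> fQ; have := cardsD1 f Q; rewrite fQ add1n => cQ.
  have sub : Q :\ f \subset nbr meets S f.
    apply/subsetP => g; rewrite !inE => /andP[gf gQ].
    by rewrite (subsetP sQS) //= Qcl // eq_sym.
  have le := subset_leq_card sub; have := Qn f fQ => le'.
  have le2 : s ^ 2 <= #|Q :\ f| by rewrite -ltnS -cQ.
  split; first by apply/eqP; rewrite eqEcard sub (leq_trans le').
  by rewrite cQ; congr _.+1; apply/eqP; rewrite eqn_leq le2 (leq_trans le).
have [f0 f0Q] : exists f, f \in Q by apply/card_gt0P; exact: leq_ltn_trans lt.
have [_ cQ] := nbrQ f0 f0Q.
have starQ x f : f \in Q -> x \in f -> star Q x = star S x.
  move=> fQ xf; apply/setP => g; rewrite !inE; case xg: (x \in g); rewrite ?andbF //.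
  rewrite !andbT; apply/idP/idP => [/(subsetP sQS) //|gS].
  have [-> //|gf] := eqVneq g f.
  have : g \in nbr meets S f.
    by rewrite inE gS; apply/meetsP; split; [apply/eqP; rewrite eq_sym | exists x].
  by have [<- _] := nbrQ f fQ; rewrite inE => /andP[].
(* Incidences counted by edges and by vertices. *)
have cnt : #|Q| * s = #|cover Q| * s.+1.
  rewrite -!sum_nat_const.
  transitivity (\sum_(f in Q) \sum_(x in cover Q | x \in f) 1).
    apply: eq_bigr => f fQ; rewrite -(Qs f fQ) -sum1_card; apply: eq_bigl => x.
    by case xf: (x \in f); rewrite ?andbF ?andbT //; apply/esym/bigcupP; exists f.
  under eq_bigr do rewrite big_mkcondr.
  rewrite exchange_big /=; apply: eq_bigr => x /bigcupP[f fQ xf].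
  rewrite -big_mkcondr /= sum1dep_card -[RHS](Qst f fQ x xf) -(starQ x f fQ xf).
  by apply: eq_card => g; rewrite !inE.
have : s.+1 %| 2.
  (* Modulo [s + 1], [s] is [-1], so [s ^ 3 + s] is [-2]. *)
  have Es : (s ^ 2).+1 * s + 2 = s.+1 * (s * s.-1 + 2) by case: (s) s2 => //= n _; nia.
  have : s.+1 %| (s ^ 2).+1 * s + 2 by rewrite Es dvdn_mulr.
  by rewrite -cQ cnt dvdn_addr // dvdn_mull.
by move=> /(dvdn_leq (isT : 0 < 2)); lia.
Qed.

(** The induction runs over subsets of the fixed [E], which inherit its bounds, so [s] and [M] stay
    the same. *)
Lemma line_colorable S : S \subset E -> @colorable_on _ 'I_M.+1 meets S.
Proof.
have [n] := ubnP #|S|; elim: n S => // n IH S ltn sSE.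
have IHS S' : S' \proper S -> @colorable_on _ 'I_M.+1 meets S'.
  move=> pS; apply: IH; first exact: leq_trans (proper_card pS) ltn.
  exact: subset_trans (proper_sub pS) sSE.
have [S0|[e0 e0S]] := set_0Vmem S.
  by exists (fun=> ord0) => y z; rewrite S0 inE.
have [/exists_inP[e eS le]|/exists_inPn big] :=
    boolP [exists e in S, #|nbr meets S e| <= M].
  have [c pc] := IHS _ (properD1 eS).
  have [||c' pc' _] := proper_extend meets_sym meets_irr (x := e) _ pc.
  - by rewrite !inE eqxx.
  - apply: leq_ltn_trans (leq_imset_card _ _) _; rewrite card_ord ltnS.
    exact: leq_trans (subset_leq_card (nbrS _ _ (subsetDl _ _))) le.
  by exists c'; rewrite setD1K in pc'.
have {}big f : f \in S -> M < #|nbr meets S f| by move=> /big; rewrite -ltnNge.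
pose e := [arg min_(f < e0 in S) #|f|].
have [eS emin] : e \in S /\ {in S, forall f, #|e| <= #|f|}.
  by rewrite /e; case: arg_minnP.
pose S' := [set f in S | #|f| == #|e|].
have S'P f : f \in S' -> [/\ #|f| = s, s ^ 2 = M.+1, #|nbr meets S f| <= s ^ 2,
     {in f, forall x, #|star S x| = s.+1} &
     {in f, forall x g, g \in S -> x \in g -> #|g| = s}].
  rewrite inE => /andP[fS /eqP fe]; apply: smallest_edge_nbr => //; last exact: big.
  by rewrite fe.
have eS' : e \in S' by rewrite inE eS eqxx.
have [es sE _ _ _] := S'P e eS'.
have s2 : 1 < s by rewrite -es E2 // (subsetP sSE).
have sS' : S' \subset S by apply/subsetP => f; rewrite inE => /andP[].
(* Hence [S'] and its complement in [S] can be coloured independently. *)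
have closed f g : f \in S' -> g \in S -> meets f g -> g \in S'.
  move=> fS' gS /meetsP[_ [x xf xg]]; have [_ _ _ _ /(_ x xf g gS xg) gs] := S'P f fS'.
  by rewrite inE gS gs es eqxx.
have [||Q sQ Qcl|c1 pc1] := brooks (C := 'I_M.+1) meets_sym meets_irr (W := S').
(* There are [s ^ 2 >= 4] colours. *)
- by rewrite card_ord -sE; case: (s) s2 => [|[|m]] // _; nia.
- move=> f fS'; rewrite card_ord -sE; have [_ _ + _ _] := S'P f fS'.
  by apply: leq_trans; apply: subset_leq_card (nbrS _ _ sS').
- rewrite card_ord -sE; apply: (@clique_bound S) => //.
  + exact: subset_trans sQ sS'.
  + by move=> f /(subsetP sQ)/S'P[].
  + by move=> f /(subsetP sQ)/S'P[].
  + by move=> f /(subsetP sQ)/S'P[].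
have [|c2 pc2] := IHS (S :\: S').
  apply/properP; split; first exact: subsetDl.
  by exists e; rewrite // inE eS'.
exists (fun f => if f \in S' then c1 f else c2 f) => f g fS gS fg.
case fS': (f \in S'); case gS': (g \in S').
- exact: pc1.
- by rewrite (closed f g) in gS'.
- by rewrite (closed g f) // meets_sym in fS'.
- by apply: pc2; rewrite // inE ?fS' ?gS'.
Qed.

End Bounded.
End LineGraph.

(** * From the line graph to the chromatic index *)

Lemma chromatic_index_le (V : finType) (H : hypergraph V) q
    (c : {set V} -> 'I_q) :
  proper_on (@meets V) (hedges H) c -> chromatic_index H <= q.
Proof.
move=> pc; rewrite /chromatic_index; case: ex_minnP => m _; apply.
apply/existsP; exists [ffun e : hedge H => c (val e)].
apply/forallP => e; apply/forallP => f; apply/implyP; rewrite !ffunE.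
apply: contraTT; rewrite negb_or andbC => ef; 
apply: pc; [exact: (valP e) | exact: (valP f) |].
case/andP: ef => ef ne; rewrite /meets ne andbT.
by apply: contraNneq ef => /val_inj ->.
Qed.

Import GRing.Theory Num.Theory.

(** Subtract one and square; for [d = 0] the predecessor is truncated to zero. *)
Lemma nat_sqr_le_sqrt (R : rcfType) (d m : nat) :
  (d%:R <= Num.sqrt (m%:R + 1) + 1 :> R)%R -> d.-1 ^ 2 <= m.+1.
Proof.
case: d => //= d; rewrite -[in X in (X <= _)%R]addn1 natrD lerD2r => le.
rewrite -(ler_nat R) natrX -[m.+1]addn1 natrD.
rewrite -[X in (_ <= X)%R]sqr_sqrtr; last first.
  by rewrite addr_ge0 ?ler0n ?ler01.
by rewrite ler_sqr ?nnegrE ?ler0n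
  ?sqrtr_ge0.
Qed.

Theorem theorem3 (R : rcfType) (V : finType) (H : hypergraph V) :
  loopless H ->
  ((hmaxdeg H)%:R <=
     Num.sqrt ((mmaxdeg (two_section H))%:R + 1) + 1 :> R)%R ->
  (chromatic_index H <= mmaxdeg (two_section H) + 1)%N.
Proof.
move=> Hll /nat_sqr_le_sqrt sM; rewrite addn1.
have [e eH|x|x|c] := line_colorable (E := hedges H) _ _ _ sM (subxx _).
- have : ~~ is_loop e by move/forall_inP: Hll; apply.
  have : 0 < #|e|.
    by rewrite card_gt0; apply: contraNneq (hedge_nonempty H) => <-.
  by rewrite /is_loop; case: #|e| => [|[]].
(* Here [s] is [(hmaxdeg H).-1]; [leqSpred] holds even if the truncation occurs. *)
- have : #|star H x| <= hmaxdeg H by exact: (leq_bigmax (F := hdeg H)).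
  by move/leq_trans; apply; exact: leqSpred.
- apply: leq_trans (leq_bigmax (F := mdeg (two_section H)) x).
  rewrite mdeg_two_section; apply/eq_leq/eq_big => [f|f _]; last by rewrite subn1.
  by rewrite inE.
- exact: chromatic_index_le.
Qed.
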